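(* There exist universal constants $\rho,\kappa\in(0,\infty)$ with the following property. Let $n\in\mathbb{N}$ and $k\in\{2,\ldots,n\}$, let $G=([n],E_G)$ be a connected $k$-regular graph with vertex set $[n]=\{1,\ldots,n\}$, and let $D\ge 1$. If $(X,\|\cdot\|)$ is a finite-dimensional real normed space into which the metric space $([n],d_G)$ embeds with average distortion $D$, then $$ \dim(X)\ge \kappa\, n^{c(G)/D},\qquad\text{where}\qquad c(G)=\frac{\rho\,(1-\lambda_2(G))}{\log k}. $$
   Context: Graphs are finite, simple and undirected. $d_G$ is the shortest-path metric induced by the connected graph $G$ on $[n]$. The normalized adjacency matrix $A_G$ of a $k$-regular graph $G=([n],E_G)$ is the $n\times n$ matrix whose $(i,j)$ entry equals $\frac1k$ if $\{i,j\}\in E_G$ and $0$ otherwise; it is symmetric and stochastic, and $\lambda_2(G)=\lambda_2(A_G)$ denotes its second-largest eigenvalue (counted with multiplicity). For $L\ge 0$, a mapping $\phi$ from a metric space $(M,d)$ to a normed space $(X,\|\cdot\|)$ is $L$-Lipschitz if $\|\phi(x)-\phi(y)\|\le L\,d(x,y)$ for all $x,y\in M$. For $D\ge 1$, a finite metric space $(M,d)$ embeds into $(X,\|\cdot\|)$ with average distortion $D$ if there exists a $D$-Lipschitz mapping $\phi:M\to X$ such that $\sum_{x,y\in M}\|\phi(x)-\phi(y)\|\ge \sum_{x,y\in M} d(x,y)$. *)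

(* Defs.v *)
From HB Require Import structures.
From mathcomp Require Import all_boot all_order all_algebra.
From mathcomp Require Import polyrcf.
From mathcomp Require Import all_classical all_reals all_analysis.
Set Implicit Arguments.
Unset Strict Implicit.
Unset Printing Implicit Defensive.

Import Order.TTheory GRing.Theory Num.Theory.
Import numFieldNormedType.Exports.

Local Open Scope ring_scope.

Record simple_graph (V : finType) := SimpleGraph {
  edge :> rel V;
  edge_sym : symmetric edge;
  edge_irrefl : irreflexive edge }.

Definition graph_connected (V : finType) (G : simple_graph V) : Prop :=
  forall x y : V, connect G x y.

Definition graph_regular (V : finType) (G : simple_graph V) (k : nat) : Prop :=
  forall x : V, #|[set y | G x y]%SET| = k.

(* Least length (number of edges) of a walk from x to y. A shortest walk visits
   no vertex twice, so lengths below #|V| suffice; #|V| is the junk value when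
   y is not reachable from x. *)
Definition graph_dist (V : finType) (G : simple_graph V) (x y : V) : nat :=
  (\big[minn/#|V|]_(m < #|V| |
      [exists p : m.-tuple V, path G x p && (last x p == y)]) m)%N.

Definition normalized_adjacency (R : realType) (n k : nat)
    (G : simple_graph 'I_n) : 'M[R]_n :=
  \matrix_(i, j) (if G i j then k%:R^-1 else 0).

(* Real eigenvalues in nonincreasing order, each repeated according to its
   algebraic multiplicity ([rootsR] lists distinct roots increasingly). *)
Definition eigenvalues (R : realType) (n : nat) (A : 'M[R]_n) : seq R :=
  rev (flatten [seq nseq (mup a (char_poly A)) a | a <- rootsR (char_poly A)]).

Definition lambda2 (R : realType) (n : nat) (A : 'M[R]_n) : R :=
  (eigenvalues A)`_1.

#[short(type="finDimNormedModType")]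
HB.structure Definition FinDimNormedModule (R : realType) :=
  {X of NormedModule R X & Vector R X}.

Definition lipschitz_map (R : realType) (M : Type) (d : M -> M -> R)
    (X : normedModType R) (L : R) (phi : M -> X) : Prop :=
  forall x y : M, `|phi x - phi y| <= L * d x y.

Definition embeds_with_average_distortion (R : realType) (M : finType)
    (d : M -> M -> R) (X : normedModType R) (D : R) : Prop :=
  exists2 phi : M -> X, lipschitz_map d D phi &
    \sum_(x : M) \sum_(y : M) `|phi x - phi y| >=
    \sum_(x : M) \sum_(y : M) d x y.

(* Main.v *)
Require Import Defs.
From HB Require Import structures.
From mathcomp Require Import all_boot all_order all_algebra.
From mathcomp Require Import all_classical all_reals all_analysis.
From mathcomp Require Import zify ring lra polyrcf.
Set Implicit Arguments.
Unset Strict Implicit.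
Unset Printing Implicit Defensive.

Import Order.TTheory GRing.Theory Num.Theory.
Import numFieldNormedType.Exports.

Local Open Scope ring_scope.

(** Let [P] be the lazy walk operator [(1 + A) / 2] of the graph.  On mean-zero
    real functions it contracts the l2 norm by the factor [(1 + mu) / 2], where
    [mu] is the maximum of the Rayleigh quotient of [A] on the orthogonal
    complement of the constants; connectedness gives [mu < 1], so that [mu] is
    an eigenvalue below the eigenvalue 1 and [mu <= lambda2 A]
    ([connected_spectral_gap]).

    Let [f] be a mean-zero function on the vertices with values in a normed
    space [X] of dimension [d].  Writing [f] in coordinates that are dominated
    by the norm of [f] ([barycentric_spanner]) shows that [P ^ t f] has l2 norm
    at most [d * ((1 + mu) / 2) ^ t] times that of [f].  Once [t] is of order
    [log d / (1 - mu)] this factor is at most 1/2 ([mixing_time]), so [f] is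
    comparable in l2 to [f - P ^ t f].  But averaging [t] times along edges of
    length at most [D] displaces each value by at most [t D / 2]
    ([avg_displacement]).  Hence the average of [|f i - f j|] over all pairs is
    O(D log d / (1 - mu)) ([spectral_poincare]): the dimension enters only
    through its logarithm, since the crude comparison of [X] with a Euclidean
    space is used for a power of [P] rather than for [f] itself.

    On the other hand, a ball of radius [r] in a k-regular graph has at most
    [1 + k + ... + k ^ r] points, so the average graph distance is at least a
    constant times [log n / log k] ([log_le_sum_graph_dist]).  Comparing the
    two bounds for an embedding of average distortion [D] gives
    [(1 - mu) log n <= C D log k log (2 d)], which is the theorem in
    logarithmic form. *)

(** * Symmetric forms on a hyperplane *)

Section Dot.
Variables (R : realType) (n : nat).
Implicit Types (u v w e : 'rV[R]_n) (A B : 'M[R]_n).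

Definition dot u v : R := (u *m v^T) 0 0.

Lemma dotE u v : dot u v = \sum_i u 0 i * v 0 i.
Proof. by rewrite /dot mxE; apply: eq_bigr => i _; rewrite mxE. Qed.

Lemma dotC u v : dot u v = dot v u.
Proof. by rewrite !dotE; apply: eq_bigr => i _; rewrite mulrC. Qed.

Lemma dotDl u v w : dot (u + v) w = dot u w + dot v w.
Proof. by rewrite /dot mulmxDl mxE. Qed.

Lemma dotZl a u v : dot (a *: u) v = a * dot u v.
Proof. by rewrite /dot -scalemxAl mxE. Qed.

Lemma dotDr u v w : dot u (v + w) = dot u v + dot u w.
Proof. by rewrite dotC dotDl !(dotC _ u). Qed.

Lemma dotZr a u v : dot u (a *: v) = a * dot u v.
Proof. by rewrite dotC dotZl dotC. Qed.

Lemma dot_ge0 u : 0 <= dot u u.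
Proof. by rewrite dotE sumr_ge0 // => i _; rewrite -expr2 sqr_ge0. Qed.

Lemma dot_eq0 u : (dot u u == 0) = (u == 0).
Proof.
apply/idP/eqP => [|->]; last by rewrite dotE big1 // => i _; rewrite mxE mul0r.
rewrite dotE psumr_eq0 => [/allP u0|i _]; last by rewrite -expr2 sqr_ge0.
apply/rowP => i; have := u0 i (mem_index_enum i).
by rewrite /= -expr2 sqrf_eq0 mxE => /eqP.
Qed.

Lemma dot_mulmxl A u v : A^T = A -> dot (u *m A) v = dot u (v *m A).
Proof. by move=> AT; rewrite /dot trmx_mul AT mulmxA. Qed.

(** Positivity is only required along the line through [u] in the direction
    [v], because the forms below are positive on a hyperplane only; the bound
    is the sign of the discriminant of the form restricted to that line. *)
Lemma psd_cauchy_schwarz B u v : B^T = B ->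
    (forall t, 0 <= dot ((u + t *: v) *m B) (u + t *: v)) ->
    0 <= dot (v *m B) v ->
  dot (u *m B) v ^+ 2 <= dot (u *m B) u * dot (v *m B) v.
Proof.
move=> BT Bge0 Bv; have Bt t : 0 <= dot (u *m B) u + 2 * t * dot (u *m B) v
    + t ^+ 2 * dot (v *m B) v.
  have := Bge0 t; rewrite mulmxDl -scalemxAl !(dotDl, dotDr, dotZl, dotZr).
  rewrite (dot_mulmxl v u BT) (dotC v); congr (_ <= _); ring.
move: (dot _ u) (dot (u *m B) v) (dot _ v) Bv Bt => a b c c0 abc.
have [c1|c1] := eqVneq c 0.
  have [->|b0] := eqVneq b 0; first by rewrite expr0n c1 mulr0.
  have := abc (- (a + 1) / (2 * b)); rewrite c1.
  have -> : 2 * (- (a + 1) / (2 * b)) * b = - (a + 1) by field.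
  lra.
have {c1}c0 : 0 < c by rewrite lt_def c1.
have := abc (- b / c); rewrite -(pmulr_lge0 _ c0).
have -> : (a + 2 * (- b / c) * b + (- b / c) ^+ 2 * c) * c = a * c - b ^+ 2.
  by field; rewrite gt_eqF.
by rewrite subr_ge0.
Qed.

Lemma quadratic_form_continuous A : continuous (fun u => dot (u *m A) u).
Proof.
have -> : (fun u => dot (u *m A) u) =
    \sum_i \sum_j (fun u => u 0 j * A j i * u 0 i).
  apply/funext => u; rewrite dotE fct_sumE; apply: eq_bigr => i _.
  by rewrite mxE fct_sumE mulr_suml.
move=> u; apply: (big_ind (fun f : 'rV[R]_n -> R => {for u, continuous f})).
- exact: cst_continuous.
- by move=> f g; exact: continuousD.
move=> i _; apply: (big_ind (fun f : 'rV[R]_n -> R => {for u, continuous f})).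
- exact: cst_continuous.
- by move=> f g; exact: continuousD.
move=> j _; apply: continuousM; last exact: coord_continuous.
by apply: continuousM; [exact: coord_continuous|exact: cst_continuous].
Qed.

Lemma linear_form_continuous e : continuous (fun u => dot u e).
Proof.
have -> : (fun u => dot u e) = \sum_i (fun u => u 0 i * e 0 i).
  by apply/funext => u; rewrite dotE fct_sumE.
move=> u; apply: (big_ind (fun f : 'rV[R]_n -> R => {for u, continuous f})).
- exact: cst_continuous.
- by move=> f g; exact: continuousD.
move=> i _.
by apply: continuousM; [exact: coord_continuous|exact: cst_continuous].
Qed.

Lemma unit_orthogonal_compact e :
  compact [set u | dot u e = 0 /\ dot u u = 1]%classic.
Proof.
apply: bounded_closed_compact.
  exists 1; split; first exact: num_real.
  move=> x x1 u [_ u1]; apply/(le_trans _ (ltW x1)).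
  rewrite [leLHS]/Num.norm /= mx_normrE; apply/bigmax_leP.
  split=> //= -[i j] _ /=.
  rewrite (ord1 i) -(@expr_le1 _ 2) // real_normK ?num_real // -u1 dotE.
  rewrite (bigD1 j) //= -expr2 lerDl sumr_ge0 // => l _.
  by rewrite -expr2 sqr_ge0.
apply: closedI.
  apply: (@preimage_closed _ _ (fun u => dot u e) [set 0]%classic).
    by move=> u _; exact: linear_form_continuous.
  exact: closed_eq.
apply: (@preimage_closed _ _ (fun u => dot u u) [set 1]%classic).
  have -> : (fun u => dot u u) = (fun u => dot (u *m 1%:M) u).
    by apply/funext => u; rewrite mulmx1.
  by move=> u _; exact: quadratic_form_continuous.
exact: closed_eq.
Qed.

(** A maximizer [v] of the Rayleigh quotient over the unit sphere of the
    hyperplane orthogonal to [e], where [mu] is the maximum.  The form of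
    [mu - A] is positive on that hyperplane and vanishes at [v], so by
    Cauchy-Schwarz [v] lies in its kernel, that is, [v] is an eigenvector. *)
Lemma max_eigenvector_orthogonal A e a :
    A^T = A -> e *m A = a *: e -> (exists2 v, v != 0 & dot v e = 0) ->
  exists mu v, [/\ v != 0, dot v e = 0, v *m A = mu *: v &
    forall u, dot u e = 0 -> dot (u *m A) u <= mu * dot u u].
Proof.
move=> AT eA [w w0 we0].
have normalize u : u != 0 ->
    let s := (Num.sqrt (dot u u))^-1 in dot (s *: u) (s *: u) = 1.
  move=> u0 /=; rewrite dotZl dotZr mulrA -invfM -expr2 sqr_sqrtr ?dot_ge0 //.
  by rewrite mulVf // dot_eq0.
set S := [set u | dot u e = 0 /\ dot u u = 1]%classic.
have cS : compact S by apply: unit_orthogonal_compact.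
have [||v] := @EVT_max_rV R n (fun u => dot (u *m A) u) S _ cS.
- by exists ((Num.sqrt (dot w w))^-1 *: w); split; [rewrite dotZl we0 mulr0|
    exact: normalize].
- by apply: continuous_subspaceT => u; exact: quadratic_form_continuous.
rewrite inE => -[ve0 v1] vmax.
pose mu := dot (v *m A) v.
have max_mu u : dot u e = 0 -> dot (u *m A) u <= mu * dot u u.
  move=> ue0; have [->|u0] := eqVneq u 0.
    by rewrite mul0mx /dot !mul0mx !mxE mulr0.
  have := vmax ((Num.sqrt (dot u u))^-1 *: u).
  rewrite inE => /(_ (conj _ (normalize _ u0))).
  rewrite dotZl ue0 mulr0 -scalemxAl dotZl dotZr mulrA -invfM -expr2.
  rewrite sqr_sqrtr ?dot_ge0 // => /(_ erefl); rewrite mulrC ler_pdivrMr //.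
  by rewrite lt_def dot_ge0 dot_eq0 u0.
have v0 : v != 0 by rewrite -dot_eq0 v1 oner_neq0.
exists mu, v; split => //.
pose B := mu%:M - A.
have BT : B^T = B by rewrite /B linearB /= tr_scalar_mx AT.
have Bge0 u : dot u e = 0 -> 0 <= dot (u *m B) u.
  move=> /max_mu; rewrite /B mulmxBr mul_mx_scalar -scaleN1r dotDl !dotZl.
  lra.
pose z := v *m B.
have ze0 : dot z e = 0.
  rewrite dot_mulmxl // /B mulmxBr mul_mx_scalar eA -scaleN1r dotDr !dotZr ve0.
  by rewrite !mulr0 addr0.
(* z is an admissible test vector, and the form of B pairs v and z to |z|^2 *)
have : dot (v *m B) z ^+ 2 <= dot (v *m B) v * dot (z *m B) z.
  apply: psd_cauchy_schwarz => [//|t|]; last exact: Bge0.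
  by apply: Bge0; rewrite dotDl dotZl ve0 ze0 mulr0 addr0.
have -> : dot (v *m B) v = 0.
  rewrite /B mulmxBr mul_mx_scalar -scaleN1r dotDl !dotZl v1 -/mu.
  by rewrite mulr1 mulN1r addrN.
rewrite mul0r -/z le_eqVlt ltNge sqr_ge0 orbF sqrf_eq0 dot_eq0 => /eqP z0.
by apply/eqP; rewrite eq_sym -subr_eq0 -mul_mx_scalar -mulmxBr -/z z0.
Qed.

Definition lazy A : 'M[R]_n := 2^-1 *: (1%:M + A).

(** Laziness makes the form positive, which lets the Rayleigh bound [mu]
    alone control the operator: apply Cauchy-Schwarz for the form of [lazy A]
    to [u] and its image.  For [A] itself, eigenvalues near -1 would
    obstruct any contraction. *)
Lemma lazy_contraction A e a mu :
    A^T = A -> e *m A = a *: e ->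
    (forall u, dot u e = 0 ->
      - dot u u <= dot (u *m A) u <= mu * dot u u) ->
  forall u, dot u e = 0 ->
  dot (u *m lazy A) (u *m lazy A) <= ((1 + mu) / 2) ^+ 2 * dot u u.
Proof.
move=> AT eA bA u ue0.
have LT : (lazy A)^T = lazy A by rewrite /lazy linearZ /= linearD /= trmx1 AT.
have bL v : dot v e = 0 ->
    0 <= dot (v *m lazy A) v <= (1 + mu) / 2 * dot v v.
  move=> /bA; rewrite /lazy -scalemxAr dotZl mulmxDr mulmx1 dotDl; lra.
pose v := u *m lazy A; have ve0 : dot v e = 0.
  rewrite dot_mulmxl // /lazy -scalemxAr mulmxDr mulmx1 eA.
  by rewrite dotZr dotDr dotZr ue0 !(mulr0, addr0).
have : dot (u *m lazy A) v ^+ 2 <= dot (u *m lazy A) u * dot (v *m lazy A) v.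
  apply: psd_cauchy_schwarz => [//|t|]; last by case/andP: (bL _ ve0).
  by have /bL/andP[] : dot (u + t *: v) e = 0
    by rewrite dotDl dotZl ue0 ve0 mulr0 addr0.
have /andP[u1 u2] := bL _ ue0; have /andP[v1 v2] := bL _ ve0.
move=> /le_trans/(_ (ler_pM u1 v1 u2 v2)); rewrite -/v.
have [->|v0] := eqVneq (dot v v) 0.
  by move=> _; rewrite mulr_ge0 ?sqr_ge0 ?dot_ge0.
have vp : 0 < dot v v by rewrite lt_def v0 dot_ge0.
move=> vv; rewrite -(ler_pM2r vp) -[leLHS]expr2; apply: (le_trans vv).
by rewrite le_eqVlt; apply/orP; left; apply/eqP; ring.
Qed.

End Dot.

(** * The second largest eigenvalue *)

Section Lambda2.
Variables (R : realType) (n : nat).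
Implicit Types (A : 'M[R]_n).

Lemma eigenvalues_sorted A : sorted >=%R (eigenvalues A).
Proof.
rewrite /eigenvalues rev_sorted sorted_pairwise; last exact: le_trans.
have : pairwise <%R (rootsR (char_poly A)).
  by rewrite -sorted_pairwise ?sorted_roots //; exact: lt_trans.
elim: (rootsR _) => //= a s IHs /andP[/allP as_ /IHs sP].
rewrite pairwise_cat sP andbT; apply/andP; split.
  apply/allrelP => x y /nseqP[-> _] /flatten_mapP[b bs /nseqP[-> _]].
  exact/ltW/as_.
by apply/(pairwiseP 0) => i j; rewrite !inE !size_nseq !nth_nseq => -> ->.
Qed.

Lemma mem_eigenvalues A a : eigenvalue A a -> a \in eigenvalues A.
Proof.
rewrite eigenvalue_root_char /eigenvalues mem_rev => ra.
have p0 : char_poly A != 0 := monic_neq0 (char_poly_monic A).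
apply/flatten_mapP; exists a.
  by rewrite -(roots_on_rootsR p0) inE /= ra.
by apply/nseqP; rewrite -XsubC_dvd // dvdp_XsubCl.
Qed.

(** Distinct eigenvalues occupy distinct places in the sorted list, so the
    smaller one cannot come before the second place. *)
Lemma le_lambda2 A a b : eigenvalue A a -> eigenvalue A b -> b < a ->
  b <= lambda2 A.
Proof.
move=> /mem_eigenvalues aA /mem_eigenvalues bA ba; rewrite /lambda2.
have ge_nth := sorted_leq_nth (@ge_trans _ R) (@ge_refl _ R) 0
  (eigenvalues_sorted A).
have ib : (0 < index b (eigenvalues A))%N.
  rewrite lt0n; apply/eqP => b0.
  have := ge_nth 0%N (index a (eigenvalues A)).
  rewrite !inE !index_mem -{1}b0 index_mem => /(_ bA aA isT).
  by rewrite -b0 !nth_index //= leNgt ba.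
have := ge_nth 1%N (index b (eigenvalues A)).
by rewrite !inE index_mem (leq_ltn_trans ib) ?index_mem // nth_index //; apply.
Qed.
End Lambda2.

(** * Bases adapted to finitely many vectors *)

Import passmx.

Section Spanner.
Variables (R : realType) (n : nat).

(** The cofactors along row [l] ignore that row, hence are those of the
    identity. *)
Lemma det_replace_row_identity m (M : 'M[R]_m) l :
  (forall i, i != l -> row i M = row i 1%:M) -> \det M = M l l.
Proof.
move=> M1; rewrite (expand_det_row M l).
have cof j : cofactor M l j = cofactor (1%:M : 'M[R]_m) l j.
  rewrite /cofactor; congr (_ * \det _).
  apply/matrixP => i i'; rewrite !mxE.
  have li : lift l i != l by rewrite eq_sym neq_lift.
  by have /rowP/(_ (lift j i')) := M1 _ li; rewrite !mxE.
have adj1 : \adj (1%:M : 'M[R]_m) = 1%:M.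
  by rewrite -[LHS]mul1mx mul_mx_adj det1.
rewrite (bigD1 l) //= big1 ?addr0 => [|j jl].
  have /matrixP/(_ l l) := adj1; rewrite !mxE eqxx cof => ->.
  by rewrite mulr1.
have /matrixP/(_ j l) := adj1; rewrite !mxE (negPf jl) cof => ->.
by rewrite mulr0.
Qed.

(** Choose, among all families of [r] rows of [Q], one that maximizes the
    determinant divided by the product of the weights.  By Cramer's rule a
    coefficient of another row in that basis is a ratio of two determinants,
    which the maximality bounds.  The hypothesis on the rows of weight 0
    keeps the junk value of a division by 0 from being the maximum. *)
Lemma barycentric_rows r (Q : 'M[R]_(n, r)) (a : 'I_n -> R) :
  row_full Q -> (forall i, 0 <= a i) -> (forall i, a i = 0 -> row i Q = 0) ->
  exists s : 'I_r -> 'I_n, exists C : 'M[R]_(n, r),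
    [/\ rowsub s Q \in unitmx, C *m rowsub s Q = Q, forall l, 0 < a (s l) &
        forall i l, `|C i l| * a (s l) <= a i].
Proof.
move=> Qfull a_ge0 a0.
pose s0 := [ffun l => fullrankfun Qfull l].
pose vol (s : {ffun 'I_r -> 'I_n}) := `|\det (rowsub s Q)| / \prod_l a (s l).
have vol_gt0 (s : {ffun _}) : rowsub s Q \in unitmx ->
    (forall l, 0 < a (s l)) /\ 0 < vol s.
  move=> sU.
  have as_gt0 l : 0 < a (s l).
    rewrite lt_def a_ge0 andbT; apply/eqP => /a0 r0.
    have : row l (rowsub s Q *m invmx (rowsub s Q)) = 0.
      by rewrite row_mul row_rowsub r0 mul0mx.
    rewrite mulmxV // => /rowP/(_ l); rewrite !mxE eqxx => /eqP.
    by rewrite oner_eq0.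
  split=> //; rewrite divr_gt0 ?prodr_gt0 // normr_gt0.
  by rewrite -unitfE -unitmxE.
have s0U : rowsub s0 Q \in unitmx.
  have -> : rowsub s0 Q = rowsub (fullrankfun Qfull) Q.
    by apply/matrixP => i j; rewrite !mxE ffunE.
  exact: fullrowsub_unit.
have [s _ smax] := @Order.TotalTheory.arg_maxP _ _ _ s0 predT vol isT.
have vs : 0 < vol s by apply: lt_le_trans (smax s0 isT); case: (vol_gt0 _ s0U).
have sU : rowsub s Q \in unitmx.
  rewrite unitmxE unitfE -normr_gt0 lt_def normr_ge0 andbT.
  by apply: contraTneq vs => d0; rewrite /vol d0 mul0r ltxx.
have [as_gt0 _] := vol_gt0 _ sU.
exists s, (Q *m invmx (rowsub s Q)); split=> //; first by rewrite mulmxKV.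
move=> i l; set C := Q *m _.
(* exchange the l-th basis row for row i, as in Cramer's rule *)
pose s' := [ffun j => if j == l then i else s j].
have detC : \det (rowsub s' Q) = C i l * \det (rowsub s Q).
  have -> : rowsub s' Q = rowsub s' C *m rowsub s Q.
    by rewrite mul_rowsub_mx mulmxKV.
  rewrite det_mulmx; congr (_ * _).
  rewrite (@det_replace_row_identity _ _ l) ?mxE ?ffunE ?eqxx // => j jl.
  rewrite row_rowsub ffunE (negPf jl) -row_rowsub.
  by rewrite -mul_rowsub_mx mulmxV.
have [ai0|ai0] := eqVneq (a i) 0.
  have : row i C = 0 by rewrite /C row_mul a0 // mul0mx.
  by move=> /rowP/(_ l); rewrite !mxE => ->; rewrite normr0 mul0r.
have := smax s' isT; rewrite /vol /= detC normrM.
rewrite (bigD1 l) // [in X in _ <= X](bigD1 l) //= ffunE eqxx.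
rewrite (eq_bigr (fun j => a (s j))) => [|j jl]; last first.
  by rewrite ffunE (negPf jl).
have : 0 < \prod_(j < r | j != l) a (s j) by rewrite prodr_gt0.
have : 0 < `|\det (rowsub s Q)| by rewrite normr_gt0 -unitfE -unitmxE.
have : 0 < a i by rewrite lt_def ai0 a_ge0.
have := as_gt0 l.
move: (a i) (a (s l)) `|C i l| `|\det _| (\prod_(_ | _) _).
move=> x y c d q y0 x0 d0 q0.
rewrite ler_pdivrMr ?mulr_gt0 // mulrAC ler_pdivlMr ?mulr_gt0 //.
have -> : c * d * (y * q) = c * y * (d * q) by ring.
have -> : d * (x * q) = x * (d * q) by ring.
by rewrite ler_pM2r ?mulr_gt0.
Qed.

(** A substitute for an Auerbach basis that needs only the finitely many
    vectors [f i]: unit vectors [b l] in number at most the dimension, in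
    which each [f i] has coordinates bounded by its own norm.  The last clause
    holds because the [b l] are linearly independent. *)
Lemma barycentric_spanner (X : finDimNormedModType R) (f : 'I_n -> X) :
  exists r (b : 'I_r -> X) (C : 'M[R]_(r, n)),
    [/\ (r <= \dim {:X})%N,
        forall i, f i = \sum_l C l i *: b l,
        forall l, `|b l| <= 1,
        forall l i, `|C l i| <= `|f i| &
        \sum_i f i = 0 -> forall l, \sum_i C l i = 0].
Proof.
have coordsK := rVofK (vbasisP {:X}).
pose F := \matrix_(i < n) rVof (vbasis {:X}) (f i).
have rowF i : row i F = rVof (vbasis {:X}) (f i) by rewrite rowK.
have [|||s [C [sU CQ as_gt0 Cle]]] :=
    @barycentric_rows _ (col_base F) (fun i => `|f i|) _ _ _.
- exact: col_base_full.
- by move=> i; exact: normr_ge0.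
- move=> i /normr0_eq0 fi0.
  have : row i (col_base F) *m row_base F = 0.
    by rewrite -row_mul mulmx_base rowF fi0 linear0.
  by move=> /eqP; rewrite mulmx_free_eq0 ?row_base_free // => /eqP.
have CF : C *m rowsub s F = F.
  by rewrite -[in RHS](mulmx_base F) -CQ -mulmxA mul_rowsub_mx mulmx_base.
exists (\rank F), (fun l => `|f (s l)|^-1 *: f (s l)).
exists (\matrix_(l, i) (C i l * `|f (s l)|)); split.
- exact: rank_leq_col.
- move=> i; apply: (can_inj coordsK); rewrite -rowF -[in LHS]CF row_mul.
  rewrite linear_sum /= mulmx_sum_row; apply: eq_bigr => l _.
  rewrite row_rowsub rowF !mxE scalerA linearZ /= -mulrA mulfV ?mulr1 //.
  by rewrite gt_eqF.
- by move=> l; rewrite normrZ gtr0_norm ?invr_gt0 // mulVf // gt_eqF.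
- by move=> l i; rewrite mxE normrM normr_id.
move=> f0 l; under eq_bigr do rewrite mxE; rewrite -mulr_suml.
suff -> : \sum_i C i l = 0 by rewrite mul0r.
have : (const_mx 1 : 'rV_n) *m C *m rowsub s F = 0.
  rewrite -mulmxA CF mulmx_sum_row.
  under eq_bigr do rewrite mxE scale1r rowF.
  by rewrite -linear_sum f0 linear0.
have -> : rowsub s F = rowsub s (col_base F) *m row_base F.
  by rewrite mul_rowsub_mx mulmx_base.
rewrite mulmxA => /eqP.
rewrite mulmx_free_eq0 ?row_base_free // => /eqP.
move=> /(congr1 (mulmxr (invmx (rowsub s (col_base F))))).
rewrite /= mulmxK // mul0mx => /rowP/(_ l); rewrite !mxE => C0.
by rewrite -[RHS]C0; apply: eq_bigr => i _; rewrite mxE mul1r.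
Qed.

End Spanner.

(** * Averaging with a stochastic matrix *)

Section Stochastic.
Variables (R : realType) (n : nat).
Implicit Types (A P : 'M[R]_n) (u : 'rV[R]_n).

Definition stochastic A :=
  (forall i j, 0 <= A i j) /\ (forall i, \sum_j A i j = 1).

Let one : 'rV[R]_n := const_mx 1.

Lemma dot_one u : dot u one = \sum_i u 0 i.
Proof. by rewrite dotE; apply: eq_bigr => i _; rewrite mxE mulr1. Qed.

Lemma symmetric_stochastic_fix_one A : A^T = A -> stochastic A ->
  one *m A = one.
Proof.
move=> AT [_ A1]; apply/rowP => i; rewrite !mxE -[RHS](A1 i).
by apply: eq_bigr => j _; rewrite mxE mul1r -[in LHS]AT mxE.
Qed.

(** Expand the square and sum rows and columns to 1.  The signs [s = 1] and
    [s = -1] give the lower and upper bound for the spectrum. *)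
Lemma dirichlet_form A u s : A^T = A -> stochastic A -> s ^+ 2 = 1 ->
  \sum_i \sum_j A i j * (u 0 i + s * u 0 j) ^+ 2 =
  2 * (dot u u + s * dot (u *m A) u).
Proof.
move=> AT [_ A1] s1.
have uu : \sum_i \sum_j A i j * u 0 i ^+ 2 = dot u u.
  rewrite dotE; apply: eq_bigr => i _.
  by rewrite -mulr_suml A1 mul1r expr2.
have uu' : \sum_i \sum_j A i j * u 0 j ^+ 2 = dot u u.
  rewrite exchange_big -uu; apply: eq_bigr => i _; apply: eq_bigr => j _.
  by rewrite -[in LHS]AT mxE.
have uAu : \sum_i \sum_j A i j * u 0 i * u 0 j = dot (u *m A) u.
  rewrite dotE exchange_big; apply: eq_bigr => j _; rewrite mxE mulr_suml.
  by apply: eq_bigr => i _; congr (_ * _); rewrite mulrC.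
transitivity (\sum_i \sum_j A i j * u 0 i ^+ 2
    + 2 * s * (\sum_i \sum_j A i j * u 0 i * u 0 j)
    + \sum_i \sum_j A i j * u 0 j ^+ 2); last by rewrite uu uu' uAu; ring.
rewrite mulr_sumr -!big_split; apply: eq_bigr => i _ /=.
rewrite mulr_sumr -!big_split; apply: eq_bigr => j _ /=.
rewrite sqrrD exprMn s1 mul1r -mulr_natl; ring.
Qed.

Lemma stochastic_form_bound A u : A^T = A -> stochastic A ->
  - dot u u <= dot (u *m A) u <= dot u u.
Proof.
move=> AT As.
have pos s : s ^+ 2 = 1 -> 0 <= dot u u + s * dot (u *m A) u.
  move=> /(dirichlet_form u AT As) form; rewrite -(@pmulr_rge0 _ 2) // -form.
  by do 2!(apply: sumr_ge0 => ? _); rewrite mulr_ge0 ?sqr_ge0 ?As.1.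
have m1 : (-1) ^+ 2 = 1 :> R by rewrite sqrrN expr1n.
have := pos 1 (expr1n _ _); have := pos (-1) (sqrr_sign _ 1).
lra.
Qed.

Definition avg (X : lmodType R) P (f : 'I_n -> X) : 'I_n -> X :=
  fun i => \sum_j P i j *: f j.

(** Averaging does not increase the supremum norm, so each of the [t] steps
    displaces by at most as much as the first. *)
Lemma avg_displacement (X : normedModType R) P (f : 'I_n -> X) d t i :
    stochastic P -> (forall j, `|f j - avg P f j| <= d) ->
  `|f i - iter t (avg P) f i| <= t%:R * d.
Proof.
move=> [P0 P1]; elim: t f i => [|t IHt] f i fd.
  by rewrite /= subrr normr0 mul0r.
rewrite iterSr -natr1 mulrDl mul1r (addrC (_ * d)).
have -> : f i - iter t (avg P) (avg P f) i =
    (f i - avg P f i) + (avg P f i - iter t (avg P) (avg P f) i).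
  by rewrite addrA subrK.
apply: le_trans (ler_normD _ _) (lerD (fd i) (IHt _ _ _)) => j.
have -> : avg P f j - avg P (avg P f) j = avg P (fun l => f l - avg P f l) j.
  rewrite /avg -sumrB; apply: eq_bigr => l _.
  by rewrite scalerBr.
apply: le_trans (ler_norm_sum _ _ _) _.
rewrite -[d]mul1r -(P1 j) mulr_suml; apply: ler_sum => l _.
by rewrite normrZ ger0_norm // ler_wpM2l.
Qed.

Lemma avg_coordinates (X : lmodType R) P r (b : 'I_r -> X)
    (C : 'M[R]_(r, n)) t i :
    P^T = P ->
  iter t (avg P) (fun i => \sum_l C l i *: b l) i =
  \sum_l iter t (mulmxr P) C l i *: b l.
Proof.
move=> PT; elim: t i => //= t IHt i.
rewrite {1}/avg (eq_bigr (fun j => \sum_l P i j *: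
  (iter t (mulmxr P) C l j *: b l))) => [|j _]; last by rewrite IHt scaler_sumr.
rewrite exchange_big; apply: eq_bigr => l _.
rewrite mxE scaler_suml; apply: eq_bigr => j _.
have <- : P i j = P j i by rewrite -{1}PT mxE.
by rewrite scalerA mulrC.
Qed.

Lemma sqr_sum_le m (a : 'I_m -> R) :
  (\sum_i a i) ^+ 2 <= m%:R * \sum_i a i ^+ 2.
Proof.
pose u : 'rV[R]_m := \row_i a i; pose e : 'rV[R]_m := const_mx 1.
have : dot (e *m 1%:M) u ^+ 2 <= dot (e *m 1%:M) e * dot (u *m 1%:M) u.
  by apply: psd_cauchy_schwarz => [|t|]; rewrite ?trmx1 ?mulmx1 ?dot_ge0.
rewrite !mulmx1 !dotE.
under eq_bigr do rewrite !mxE mul1r.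
under [X in _ <= X * _]eq_bigr do rewrite !mxE mul1r.
under [X in _ <= _ * X]eq_bigr do rewrite !mxE -expr2.
by rewrite sumr_const card_ord.
Qed.

Lemma lazy_stochastic A : A^T = A -> stochastic A ->
  (lazy A)^T = lazy A /\ stochastic (lazy A).
Proof.
move=> AT [A0 A1]; split; first by rewrite linearZ /= linearD /= trmx1 AT.
split=> [i j|i]; first by rewrite !mxE mulr_ge0 ?addr_ge0 ?ler0n.
under eq_bigr do rewrite !mxE mulrDr.
rewrite big_split /= -!mulr_sumr A1 (bigD1 i) //= eqxx big1 => [|j ji].
  by rewrite addr0 -mulrDr mulVf.
by rewrite eq_sym (negPf ji).
Qed.

Lemma lazy_iter_contraction A mu t u : A^T = A -> stochastic A ->
    (forall u, dot u one = 0 -> dot (u *m A) u <= mu * dot u u) ->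
    dot u one = 0 ->
  let v := iter t (mulmxr (lazy A)) u in
  dot v v <= ((1 + mu) / 2) ^+ (2 * t) * dot u u.
Proof.
move=> AT As Amu /= u0; set w := iter t _ u.
suff [] : dot w one = 0 /\ dot w w <= ((1 + mu) / 2) ^+ (2 * t) * dot u u by [].
have [LT Ls] := lazy_stochastic AT As.
rewrite {}/w; elim: t => [|t [v0 vu]] /=; first by rewrite muln0 mul1r.
split; first by rewrite dot_mulmxl // symmetric_stochastic_fix_one.
have A1 : one *m A = 1 *: one by rewrite scale1r symmetric_stochastic_fix_one.
apply: (@le_trans _ _ (((1 + mu) / 2) ^+ 2 * dot (iter t (mulmxr (lazy A)) u)
    (iter t (mulmxr (lazy A)) u))).
  apply: (lazy_contraction AT A1) => // x x0; rewrite Amu // andbT.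
  by case/andP: (stochastic_form_bound x AT As).
by rewrite mulnS exprD -mulrA ler_wpM2l ?sqr_ge0.
Qed.

(** With [e i] the norm of the [t]-th lazy average of [f] at [i], the
    displacement bound gives [|f i| <= t L / 2 + e i].  Bounding [e i] by the
    sum of the absolute coordinates and contracting each coordinate row, the
    sum of the [e i ^ 2] is at most [(\dim X * ((1 + mu) / 2) ^ t) ^ 2], hence
    at most a quarter, of the sum of the [|f i| ^ 2], and can be absorbed. *)
Lemma mean_zero_bound (X : finDimNormedModType R) A mu L t (f : 'I_n -> X) :
    A^T = A -> stochastic A -> -1 <= mu ->
    (forall u, dot u one = 0 -> dot (u *m A) u <= mu * dot u u) ->
    (forall i j, A i j != 0 -> `|f i - f j| <= L) -> 0 <= L ->
    \sum_i f i = 0 ->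
    2 * (\dim {:X})%:R * ((1 + mu) / 2) ^+ t <= 1 ->
  \sum_i `|f i| ^+ 2 <= n%:R * (t%:R * L) ^+ 2.
Proof.
move=> AT As mu1 Amu fL L0 f0 tdim.
have [LT Ls] := lazy_stochastic AT As.
have [r [b [C [rdim fE b1 Cf C0]]]] := barycentric_spanner f.
pose Ct := iter t (mulmxr (lazy A)) C.
have disp i : `|f i| <= t%:R * (L / 2) + \sum_l `|Ct l i|.
  (* a lazy step stays put with probability 1/2 *)
  have fd j : `|f j - avg (lazy A) f j| <= L / 2.
    have -> : f j - avg (lazy A) f j = 2^-1 *: \sum_l A j l *: (f j - f l).
      have -> : avg (lazy A) f j = 2^-1 *: (f j + \sum_l A j l *: f l).
        rewrite /avg /lazy; under eq_bigr do rewrite !mxE -scalerA scalerDl.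
        rewrite -scaler_sumr big_split /= (bigD1 j) //= eqxx scale1r.
        rewrite big1 ?addr0 // => l lj.
        by rewrite eq_sym (negPf lj) scale0r.
      under [in RHS]eq_bigr do rewrite scalerBr.
      rewrite sumrB -scaler_suml As.2 scale1r !scalerDr scalerN.
      have {1}-> : f j = 2^-1 *: f j + 2^-1 *: f j.
        by rewrite -scalerDl -[X in X *: _](_ : 1 = _) ?scale1r //; field.
      by rewrite opprD addrA addrK.
    rewrite normrZ ger0_norm // mulrC ler_wpM2r //.
    apply: le_trans (ler_norm_sum _ _ _) _.
    rewrite -[L]mul1r -(As.2 j) mulr_suml; apply: ler_sum => l _.
    rewrite normrZ ger0_norm ?As.1 //.
    have [->|Ajl] := eqVneq (A j l) 0; first by rewrite !mul0r.
    by rewrite ler_wpM2l ?As.1 ?fL.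
  rewrite -[f i](subrK (iter t (avg (lazy A)) f i)).
  apply: le_trans (ler_normD _ _) (lerD (avg_displacement _ _ Ls fd) _).
  have -> : f = fun i => \sum_l C l i *: b l by apply/funext.
  rewrite avg_coordinates //; apply: le_trans (ler_norm_sum _ _ _) _.
  by apply: ler_sum => l _; rewrite normrZ ler_piMr.
have rowCt l : row l Ct = iter t (mulmxr (lazy A)) (row l C).
  rewrite /Ct; elim: (t) => //= s <-; exact: row_mul.
have Ctl l : \sum_i `|Ct l i| ^+ 2 <=
    ((1 + mu) / 2) ^+ (2 * t) * \sum_i `|f i| ^+ 2.
  have -> : \sum_i `|Ct l i| ^+ 2 = dot (row l Ct) (row l Ct).
    by rewrite dotE; apply: eq_bigr => i _; rewrite !mxE real_normK ?num_real.
  rewrite rowCt; apply: le_trans (lazy_iter_contraction _ AT As Amu _) _.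
    by rewrite dot_one; under eq_bigr do rewrite mxE; exact: C0.
  rewrite ler_wpM2l //; first by rewrite mulnC exprM sqr_ge0.
  rewrite dotE ler_sum // => i _.
  by rewrite !mxE -expr2 -real_normK ?num_real // lerXn2r ?nnegrE.
have e2 : \sum_i (\sum_l `|Ct l i|) ^+ 2 <=
    r%:R ^+ 2 * (((1 + mu) / 2) ^+ (2 * t) * \sum_i `|f i| ^+ 2).
  apply: (@le_trans _ _ (\sum_i r%:R * \sum_l `|Ct l i| ^+ 2)).
    by apply: ler_sum => i _; exact: sqr_sum_le.
  rewrite -mulr_sumr exchange_big expr2 -mulrA ler_wpM2l // mulr_natl.
  rewrite -[X in _ <= _ *+ X]card_ord -sumr_const.
  by apply: ler_sum => l _; exact: Ctl.
have small : r%:R ^+ 2 * ((1 + mu) / 2) ^+ (2 * t) <= 4^-1.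
  have h0 : 0 <= ((1 + mu) / 2) ^+ t by rewrite exprn_ge0 //; lra.
  have h1 : r%:R * ((1 + mu) / 2) ^+ t <= 2^-1.
    apply: (@le_trans _ _ ((\dim {:X})%:R * ((1 + mu) / 2) ^+ t)).
      by rewrite ler_wpM2r // ler_nat.
    lra.
  have -> : 4^-1 = 2^-1 ^+ 2 :> R by field.
  by rewrite mulnC exprM -exprMn lerXn2r ?nnegrE ?mulr_ge0.
have F0 : 0 <= \sum_i `|f i| ^+ 2 by apply: sumr_ge0 => i _; exact: sqr_ge0.
have step : \sum_i `|f i| ^+ 2 <=
    n%:R * (2 * (t%:R * (L / 2)) ^+ 2) + 2 * \sum_i (\sum_l `|Ct l i|) ^+ 2.
  rewrite mulr_natl -[X in _ <= _ *+ X + _]card_ord -sumr_const mulr_sumr.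
  rewrite -big_split /=; apply: ler_sum => i _.
  apply: (@le_trans _ _ ((t%:R * (L / 2) + \sum_l `|Ct l i|) ^+ 2)).
    by rewrite lerXn2r ?nnegrE // (le_trans _ (disp i)).
  have := sqr_ge0 (t%:R * (L / 2) - \sum_l `|Ct l i|); rewrite sqrrB sqrrD.
  lra.
have := ler_wpM2r F0 small; rewrite -mulrA => /(le_trans e2).
move: step; have -> : (t%:R * (L / 2)) ^+ 2 = (t%:R * L) ^+ 2 / 4 by field.
move: (\sum_i `|f i| ^+ 2) (\sum_i _ ^+ 2) => a c.
have -> : n%:R * (2 * ((t%:R * L) ^+ 2 / 4)) = n%:R * (t%:R * L) ^+ 2 / 2.
  by field.
lra.
Qed.

(** Centre [x] at its mean and combine the l2 bound with Cauchy-Schwarz and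
    the triangle inequality. *)
Lemma spectral_poincare (X : finDimNormedModType R) A mu L t (x : 'I_n -> X) :
    A^T = A -> stochastic A -> -1 <= mu ->
    (forall u, dot u one = 0 -> dot (u *m A) u <= mu * dot u u) ->
    (forall i j, A i j != 0 -> `|x i - x j| <= L) -> 0 <= L ->
    2 * (\dim {:X})%:R * ((1 + mu) / 2) ^+ t <= 1 ->
  \sum_i \sum_j `|x i - x j| <= 2 * n%:R ^+ 2 * (t%:R * L).
Proof.
move=> AT As mu1 Amu xL L0 tdim.
have [n0|n0] := posnP n.
  rewrite big1 => [|i _]; first by rewrite n0 expr0n mulr0 mul0r.
  by have := leq_trans (ltn_ord i) (eq_leq n0).
pose f i := x i - n%:R^-1 *: \sum_j x j.
have fE i j : f i - f j = x i - x j by rewrite /f opprB addrA subrK.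
have f0 : \sum_i f i = 0.
  rewrite /f sumrB sumr_const card_ord -scaler_nat scalerA divff.
    by rewrite scale1r subrr.
  by rewrite pnatr_eq0 -lt0n.
have F : \sum_i `|f i| ^+ 2 <= n%:R * (t%:R * L) ^+ 2.
  by apply: (mean_zero_bound AT As mu1 Amu) => // i j; rewrite fE; exact: xL.
have S : \sum_i `|f i| <= n%:R * (t%:R * L).
  rewrite -(@ler_pXn2r _ 2) ?nnegrE ?sumr_ge0 ?mulr_ge0 //.
  apply: le_trans (sqr_sum_le _) _; rewrite exprMn expr2 -mulrA.
  by rewrite ler_wpM2l.
apply: (@le_trans _ _ (\sum_i \sum_j (`|f i| + `|f j|))).
  by do 2!(apply: ler_sum => ? _); rewrite -fE ler_normB.
have -> : \sum_i \sum_j (`|f i| + `|f j|) = 2 * n%:R * \sum_i `|f i|.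
  under eq_bigr do rewrite big_split /= sumr_const card_ord -mulr_natl.
  rewrite big_split /= -mulr_sumr sumr_const card_ord -mulr_natl; ring.
have -> : 2 * n%:R ^+ 2 * (t%:R * L) = 2 * n%:R * (n%:R * (t%:R * L)) by ring.
by rewrite ler_wpM2l // mulr_ge0.
Qed.

End Stochastic.

(** * Regular graphs *)

Section RegularGraph.
Variables (R : realType) (n k : nat) (G : simple_graph 'I_n).
Hypotheses (Gk : graph_regular G k) (k0 : (0 < k)%N).
Let A := normalized_adjacency R k G.

Lemma normalized_adjacency_sym : A^T = A.
Proof. by apply/matrixP => i j; rewrite !mxE edge_sym. Qed.

Lemma normalized_adjacency_stochastic : stochastic A.
Proof.
split=> [i j|i]; first by rewrite mxE; case: ifP => // _; rewrite invr_ge0.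
under eq_bigr do rewrite mxE.
rewrite -big_mkcond /= sumr_const -cardsE Gk -[LHS]mulr_natl.
by rewrite mulfV // pnatr_eq0 -lt0n.
Qed.

(** If the maximal Rayleigh quotient [mu] on mean-zero vectors were 1, the
    Dirichlet form of its eigenvector would vanish; the eigenvector would be
    constant along edges, hence constant by connectedness, hence 0. *)
Lemma connected_spectral_gap : (1 < n)%N -> graph_connected G ->
  exists mu, [/\ -1 <= mu < 1, mu <= lambda2 A &
    forall u, dot u (const_mx 1) = 0 -> dot (u *m A) u <= mu * dot u u].
Proof.
move=> n1 Gc; pose one : 'rV[R]_n := const_mx 1.
have AT := normalized_adjacency_sym; have As := normalized_adjacency_stochastic.
have A1 := symmetric_stochastic_fix_one AT As.
have A1' : one *m A = 1 *: one by rewrite scale1r.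
have ortho : exists2 v : 'rV[R]_n, v != 0 & dot v one = 0.
  pose i0 := Ordinal (ltnW n1); pose i1 := Ordinal n1.
  exists (delta_mx 0 i0 - delta_mx 0 i1).
    apply/eqP => /rowP/(_ i0); rewrite !mxE !eqxx /= subr0 => /eqP.
    by rewrite oner_eq0.
  rewrite dot_one; under eq_bigr do rewrite !mxE eqxx /=.
  rewrite sumrB (bigD1 i0) //= [X in _ - X](bigD1 i1) //= ?eqxx !big1 ?subrr //.
    by move=> i /negPf->.
  by move=> i /negPf->.
have [mu [v [v0 ve vA Amu]]] := max_eigenvector_orthogonal AT A1' ortho.
have vv : 0 < dot v v by rewrite lt_def dot_ge0 dot_eq0 v0.
have := stochastic_form_bound v AT As; rewrite vA dotZl => /andP[lo hi].
have mu1 : -1 <= mu by rewrite -(ler_pM2r vv) mulN1r.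
have mu_le1 : mu <= 1 by rewrite -(ler_pM2r vv) mul1r.
have mu_neq1 : mu != 1.
  apply: contra_neq v0 => mu_eq1.
  have m1 : (-1) ^+ 2 = 1 :> R by rewrite sqrrN expr1n.
  have := dirichlet_form v AT As m1.
  rewrite vA mu_eq1 scale1r mulN1r subrr mulr0 => /eqP.
  have pos i j : 0 <= A i j * (v 0 i + -1 * v 0 j) ^+ 2.
    by rewrite mulr_ge0 ?sqr_ge0 ?As.1.
  rewrite psumr_eq0 => [/allP Ai|i _]; last exact: sumr_ge0.
  have edge_eq i j : G i j -> v 0 i = v 0 j.
    move=> Gij; have := Ai i (mem_index_enum i); rewrite /= psumr_eq0 //.
    move=> /allP/(_ j (mem_index_enum j)); rewrite /= mxE Gij mulf_eq0 invr_eq0.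
    rewrite pnatr_eq0 gtn_eqF //= sqrf_eq0 mulN1r subr_eq0 => /eqP; exact.
  have const i j : v 0 i = v 0 j.
    have cl : closed_mem (edge G) (mem [pred l | v 0 l == v 0 j]).
      by move=> l l' /edge_eq e; rewrite !inE e.
    have := closed_connect cl (Gc i j); rewrite !inE eqxx => /eqP; exact.
  apply/rowP => i; rewrite mxE; move: ve; rewrite dot_one.
  under eq_bigr do rewrite (const _ i).
  rewrite sumr_const card_ord -mulr_natl => /eqP.
  by rewrite mulf_eq0 pnatr_eq0 gtn_eqF ?(ltnW n1) //= => /eqP.
have mu_lt1 : mu < 1 by rewrite lt_neqAle mu_neq1.
exists mu; split => //; first by rewrite mu1.
apply: (le_lambda2 (a := 1)) => //; apply/eigenvalueP.
  exists one => //; apply/eqP => /rowP/(_ (Ordinal n1)); rewrite !mxE => /eqP.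
  by rewrite oner_eq0.
by exists v.
Qed.

End RegularGraph.

Section GraphGrowth.
Variables (V : finType) (G : simple_graph V) (k : nat).
Hypothesis Gk : graph_regular G k.

(** The endpoints of walks of length exactly [m] from [x]; defined by
    iterated neighbourhoods so that the count is an induction on [m]. *)
Fixpoint walk_ends (x : V) m : {set V} :=
  if m is m'.+1 then \bigcup_(z in walk_ends x m') [set y | G z y]%SET
  else [set x]%SET.

Lemma card_walk_ends x m : (#|walk_ends x m| <= k ^ m)%N.
Proof.
elim: m => [|m IHm] /=; first by rewrite cards1.
have -> : (k ^ m.+1 = k ^ m * k)%N by rewrite expnSr.
apply: leq_trans (leq_mul IHm (leqnn k)).
rewrite -sum_nat_const.
apply: (big_ind2 (fun (B : {set V}) c => (#|B| <= c)%N)).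
- by rewrite cards0.
- move=> B c B' c' Bc Bc'.
  by rewrite (leq_trans (leq_card_setU _ _)) // leq_add.
- by move=> z _; rewrite Gk.
Qed.

Lemma path_walk_ends x p : path G x p -> last x p \in walk_ends x (size p).
Proof.
elim/last_ind: p => [|p y IHp] /=; first by rewrite finset.in_set1.
rewrite rcons_path last_rcons size_rcons => /andP[/IHp xp py] /=.
by apply/bigcupP; exists (last x p); rewrite ?inE.
Qed.

(** The bound excludes the default value of the minimum that defines
    [graph_dist]. *)
Lemma graph_distP x y : (graph_dist G x y < #|V|)%N ->
  y \in walk_ends x (graph_dist G x y).
Proof.
rewrite /graph_dist.
apply: (big_ind (fun d => (d < #|V|)%N -> y \in walk_ends x d)).
- by rewrite ltnn.
- by move=> d e; rewrite /minn; case: ifP.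
move=> m /existsP[p /andP[xp /eqP <-]] _.
by rewrite -{2}(size_tuple p); exact: path_walk_ends.
Qed.

Lemma graph_dist_edge x y : G x y -> (graph_dist G x y <= 1)%N.
Proof.
move=> xy; have V1 : (1 < #|V|)%N.
  apply/card_gt1P; exists x, y; split => //; apply: contraTneq xy => ->.
  by rewrite edge_irrefl.
rewrite /graph_dist -minEnat -leEnat.
apply: (@bigmin_inf _ _ _ _ (Ordinal V1)) => //.
by apply/existsP; exists [tuple y]; rewrite /= xy eqxx.
Qed.

Lemma card_ball_le x r : (r <= #|V|)%N ->
  (#|[set y | graph_dist G x y < r]%SET| <= \sum_(m < r) k ^ m)%N.
Proof.
move=> rV.
have sub : [set y | (graph_dist G x y < r)%N]%SET \subset
    \bigcup_(m < r) walk_ends x m.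
  apply/fintype.subsetP => y; rewrite inE => xy.
  apply/bigcupP; exists (Ordinal xy) => //=.
  exact/graph_distP/(leq_trans xy).
apply: leq_trans (subset_leq_card sub) _ => {sub rV}.
apply: (big_ind2 (fun (B : {set V}) c => (#|B| <= c)%N)).
- by rewrite cards0.
- move=> B c B' c' Bc Bc'.
  by rewrite (leq_trans (leq_card_setU _ _)) // leq_add.
- by move=> m _; exact: card_walk_ends.
Qed.

Lemma geometric_sum_bounds r : (1 < k)%N ->
  (r <= \sum_(m < r) k ^ m < k ^ r)%N.
Proof.
move=> k1; elim: r => [|r /andP[IHr1 IHr2]]; first by rewrite big_ord0.
rewrite big_ord_recr /=; apply/andP; split.
  by rewrite -addn1 leq_add // expn_gt0 (ltn_trans _ k1).
rewrite expnS; apply: (@leq_trans (k ^ r + k ^ r)%N).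
  by rewrite -addSn leq_add.
by rewrite addnn -mul2n leq_mul2r k1 orbT.
Qed.

(** Let [r] be the largest radius for which the bound [1 + ... + k ^ (r - 1)]
    on the ball of radius less than [r] does not exceed [n / 2].  Half of the
    vertices are at distance at least [r] from [x], and maximality of [r]
    gives [n <= k ^ (r + 2) <= k ^ (3 r)]. *)
Lemma log_le_sum_graph_dist (R : realType) x : (1 < k <= #|V|)%N ->
  #|V|%:R * ln #|V|%:R <= 6 * ln k%:R * \sum_y (graph_dist G x y)%:R :> R.
Proof.
move=> /andP[k1 kV]; set n := #|V|; have n1 := leq_trans k1 kV.
pose S r := (\sum_(m < r) k ^ m)%N.
have rS r : (r <= S r < k ^ r)%N := geometric_sum_bounds r k1.
have exr : exists r, (2 * S r <= n)%N by exists 0%N; rewrite /S big_ord0.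
have [r Sr rmax] :
    {r | (2 * S r <= n)%N & forall j, (2 * S j <= n)%N -> (j <= r)%N}.
  have bnd j : (2 * S j <= n)%N -> (j <= n)%N.
    have /andP[jS _] := rS j; lia.
  by case: (ex_maxnP exr bnd) => r ? ?; exists r.
have r1 : (0 < r)%N by apply: rmax; rewrite /S big_ord1 expn0 muln1.
have nk : (n <= k ^ (3 * r))%N.
  have : ~~ (2 * S r.+1 <= n)%N by apply/negP => /rmax; rewrite ltnn.
  rewrite -ltnNge => nS; have /andP[_ Sk] := rS r.+1.
  apply: (@leq_trans (2 * k ^ r.+1)); first lia.
  apply: (@leq_trans (k ^ r.+2)).
    by rewrite (expnS k r.+1) leq_mul2r k1 orbT.
  by rewrite leq_pexp2l ?(ltn_trans _ k1) //; lia.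
have half : (n <= 2 * #|~: [set y | graph_dist G x y < r]%SET|)%N.
  have rn : (r <= n)%N by have /andP[] := rS r; lia.
  have := card_ball_le x rn; rewrite -/(S r).
  have := cardsC [set y | (graph_dist G x y < r)%N]%SET.
  rewrite -/n; lia.
have sum_ge : n%:R * r%:R <= 2 * \sum_y (graph_dist G x y)%:R :> R.
  rewrite -natr_sum -!natrM ler_nat.
  apply: leq_trans (leq_mul half (leqnn r)) _.
  rewrite -mulnA leq_mul2l /= -sum_nat_const.
  set far := (~: _)%SET; rewrite [leqRHS](bigID [pred y | y \in far]) /=.
  rewrite -[leqLHS]addn0 leq_add // leq_sum // => y.
  by rewrite /far !inE -leqNgt.
have lnk : 0 < ln k%:R :> R by rewrite ln_gt0 // ltr1n.
have lnn : ln n%:R <= 3 * r%:R * ln k%:R :> R.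
  have -> : 3 * r%:R * ln k%:R = ln ((k ^ (3 * r))%N%:R) :> R.
    by rewrite natrX lnXn ?ltr0n ?(ltn_trans _ k1) // -[RHS]mulr_natl natrM.
  rewrite ler_ln ?posrE ?ltr0n ?expn_gt0 ?(ltn_trans _ k1) ?(ltn_trans _ n1) //.
  by rewrite ler_nat.
apply: le_trans (ler_wpM2l (ler0n R n) lnn) _.
have -> : n%:R * (3 * r%:R * ln k%:R) = 3 * ln k%:R * (n%:R * r%:R) :> R.
  by ring.
apply: (@le_trans _ _ (3 * ln k%:R * (2 * \sum_y (graph_dist G x y)%:R))).
  by rewrite ler_wpM2l // mulr_ge0 // ltW.
by rewrite le_eqVlt; apply/orP; left; apply/eqP; ring.
Qed.

End GraphGrowth.

(** * The dimension bound *)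

(** [t] is [2 ln (2 d) / (1 - mu)] rounded up, by [1 + x <= exp x]; the
    rounding error is absorbed since [1 - mu <= 2 <= 4 ln (2 d)]. *)
Lemma mixing_time (R : realType) (d : nat) (mu : R) :
    (0 < d)%N -> -1 <= mu < 1 ->
  exists2 t : nat, 2 * d%:R * ((1 + mu) / 2) ^+ t <= 1 &
    (1 - mu) * t%:R <= 6 * ln (2 * d%:R).
Proof.
move=> d0 /andP[mu1 mu2]; set g := 1 - mu; have g0 : 0 < g by rewrite subr_gt0.
have d2 : 2 <= 2 * d%:R :> R by rewrite ler_peMr // ler1n.
set l := ln (2 * d%:R).
have l1 : 2^-1 <= l.
  have V1 : (2 * d%:R)^-1 <= 2^-1 :> R by rewrite lef_pV2 ?posrE //; lra.
  have V0 : 0 < (2 * d%:R)^-1 :> R by rewrite invr_gt0; lra.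
  have V2 : -1 < (2 * d%:R)^-1 - 1 :> R by lra.
  have := le_ln1Dx V2; rewrite addrC subrK lnV ?posrE -?/l; lra.
pose t := (Num.trunc (2 * l / g)).+1.
have tlo : 2 * l / g <= t%:R by exact/ltW/truncnS_gt.
have thi : t%:R <= 2 * l / g + 1.
  by rewrite /t -natr1 lerD2r truncn_le divr_ge0 ?(ltW g0) // mulr_ge0 //; lra.
exists t; last first.
  have := ler_wpM2l (ltW g0) thi.
  have -> : g * (2 * l / g + 1) = 2 * l + g by field; rewrite gt_eqF.
  rewrite /g; lra.
have -> : (1 + mu) / 2 = 1 + - (g / 2) by rewrite /g; field.
apply: (@le_trans _ _ (2 * d%:R * expR (- (g / 2)) ^+ t)).
  rewrite ler_wpM2l ?mulr_ge0 // lerXn2r ?nnegrE ?expR_ge0 ?expR_ge1Dx //.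
  rewrite /g; lra.
rewrite -[2 * d%:R]lnK ?posrE; last by lra.
rewrite -/l -expRM_natl -expRD -[leRHS]expR0 ler_expR.
move: tlo; rewrite ler_pdivrMr // => tlo; lra.
Qed.

(** The volume bound for the average distance against the Poincare
    inequality, edges having length at most [D] in the image. *)
Lemma log_size_bound (R : realType) n k (G : simple_graph 'I_n) (D mu : R)
    (X : finDimNormedModType R) t :
    (2 <= k <= n)%N -> graph_regular G k -> 1 <= D -> -1 <= mu ->
    (forall u, dot u (const_mx 1) = 0 ->
      dot (u *m normalized_adjacency R k G) u <= mu * dot u u) ->
    embeds_with_average_distortion
      (fun x y : 'I_n => (graph_dist G x y)%:R) X D ->
    2 * (\dim {:X})%:R * ((1 + mu) / 2) ^+ t <= 1 ->
  ln n%:R <= 12 * ln k%:R * (t%:R * D).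
Proof.
move=> /andP[k2 kn] Gk D1 mu1 Amu [phi lip avg_ge] tdim.
have k0 : (0 < k)%N by apply: leq_trans k2.
have n0 : 0 < n%:R :> R by rewrite ltr0n (leq_trans k0).
have D0 : 0 <= D by apply: le_trans D1.
have phiD i j : normalized_adjacency R k G i j != 0 -> `|phi i - phi j| <= D.
  rewrite mxE; case: ifP => [Gij _|]; last by rewrite eqxx.
  apply: le_trans (lip i j) _; rewrite -[leRHS]mulr1 ler_wpM2l // lern1.
  exact: graph_dist_edge.
have upper := spectral_poincare (normalized_adjacency_sym R k G)
  (normalized_adjacency_stochastic R Gk k0) mu1 Amu phiD D0 tdim.
have lower : n%:R * (n%:R * ln n%:R) <=
    6 * ln k%:R * \sum_x \sum_y (graph_dist G x y)%:R :> R.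
  have -> : n%:R * (n%:R * ln n%:R) = \sum_(x < n) (n%:R * ln n%:R) :> R.
    by rewrite sumr_const card_ord -[RHS]mulr_natl.
  rewrite mulr_sumr.
  apply: ler_sum => x _; have := log_le_sum_graph_dist Gk R x.
  by rewrite card_ord; apply; rewrite k2.
have lnk : 0 < ln k%:R :> R by rewrite ln_gt0 // ltr1n.
have := ler_wpM2l (ltW lnk) (le_trans avg_ge upper) => /= up.
have nn : 0 < n%:R * n%:R :> R by exact: mulr_gt0.
rewrite -(ler_pM2l nn).
lra.
Qed.

Theorem corollary2 (R : realType) :
  exists rho kappa : R,
    [/\ 0 < rho, 0 < kappa &
      forall (n k : nat) (G : simple_graph 'I_n) (D : R)
             (X : finDimNormedModType R),
        (2 <= k <= n)%N ->
        graph_connected G ->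
        graph_regular G k ->
        1 <= D ->
        embeds_with_average_distortion
          (fun x y : 'I_n => (graph_dist G x y)%:R) X D ->
        let c := rho * (1 - lambda2 (normalized_adjacency R k G)) / ln k%:R in
        (\dim {:X})%:R >= kappa * n%:R `^ (c / D)].
Proof.
(* 72 is the product of the constants of [log_size_bound] and [mixing_time];
   1/2 compensates the factor 2 inside the logarithm *)
exists 72^-1, 2^-1; split=> // n k G D X kn Gc Gk D1 emb /=.
have /andP[k2 kn'] := kn; have n1 := leq_trans k2 kn'.
have D0 : 0 < D by apply: lt_le_trans D1.
have lnk : 0 < ln k%:R :> R by rewrite ln_gt0 // ltr1n.
have lnn : 0 < ln n%:R :> R by rewrite ln_gt0 // ltr1n.
have [mu [mu1 mu_l2 Amu]] :=
  connected_spectral_gap R Gk (ltnW k2) n1 Gc.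
have /andP[mu_ge mu_lt] := mu1.
have bound t := log_size_bound (t := t) kn Gk D1 mu_ge Amu emb.
(* in dimension 0 no averaging is needed: already t = 0 gives ln n <= 0 *)
have d0 : (0 < \dim {:X})%N.
  rewrite lt0n; apply/eqP => d0; have := bound 0%N.
  by rewrite d0 mulr0 mul0r mul0r mulr0 ler01 leNgt lnn => /(_ isT).
have [t tdim tle] := mixing_time d0 mu1.
set d : R := (\dim {:X})%:R in tle *.
have d1 : 0 < 2 * d by rewrite mulr_gt0 // ltr0n.
rewrite mulrC ler_pdivrMr // (mulrC d) /powR pnatr_eq0 gtn_eqF ?(ltnW n1) //.
rewrite /= -[leRHS]lnK ?posrE // ler_expR.
set c := (X in X / D).
have -> : c / D * ln n%:R = 72^-1 *
    ((1 - lambda2 (normalized_adjacency R k G)) * (ln n%:R / (ln k%:R * D))).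
  by rewrite /c; field; rewrite !gt_eqF.
have : ln n%:R / (ln k%:R * D) <= 12 * t%:R.
  by rewrite ler_pdivrMr ?mulr_gt0 //; have := bound t tdim; lra.
have : 0 <= ln n%:R / (ln k%:R * D) by rewrite ltW // divr_gt0 ?mulr_gt0.
move: (ln n%:R / _) => q q0 qt.
have q1 : (1 - lambda2 (normalized_adjacency R k G)) * q <= (1 - mu) * q.
  by rewrite ler_wpM2r // lerD2l lerN2.
have : (1 - mu) * q <= (1 - mu) * (12 * t%:R).
  by rewrite ler_wpM2l // subr_ge0 ltW.
lra.
Qed.
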